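(* Let $G$ be a non-archimedean Polish group with a fundamental action $G\curvearrowright\mathbb N$, and consider the Bernoulli shift action of $G$ on $\mathbb R^{\mathbb N}$. Then $G$ is not CLI if and only if the $G$-space $\mathbb R^{\mathbb N}$ satisfies the following: for every comeager subset $C$ of $\mathbb R^{\mathbb N}$ there are $x,y\in C$ such that $[x]\neq[y]$ and $x$ right Becker-embeds into $y$.
   Context: A non-archimedean Polish group is a Polish group admitting a neighborhood basis at the identity consisting of open subgroups. Such a group can be written (up to topological isomorphism) as $G=\mathrm{Aut}(\mathcal N)\subseteq \mathrm{Sym}(\mathbb N)$ for a structure $\mathcal N$ with universe $\mathbb N$ in a countable language; equivalently $G$ is a closed subgroup of $\mathrm{Sym}(\mathbb N)$ (the group of all permutations of $\mathbb N$ with the pointwise convergence topology). The resulting action $G\curvearrowright\mathbb N$ is called a fundamental action. The Bernoulli shift for $G$ is the action of $G$ on the space $\mathbb R^{\mathbb N}$ (product topology) given by $(g\cdot x)(n)=x(g^{-1}(n))$. $[x]$ denotes the $G$-orbit of $x$. A Polish group is CLI if it admits a complete left-invariant metric compatible with its topology. A sequence $(h_n)$ in a Polish group $H$ is left-Cauchy if it is Cauchy with respect to some topologically compatible left-invariant metric on $H$; it is right-Cauchy if $(h_n^{-1})$ is left-Cauchy. If $X$ is a Polish $H$-space (Polish space with a continuous $H$-action) and $x,y\in X$, then $x$ right Becker-embeds into $y$ if there is a right-Cauchy sequence $(h_n)$ in $H$ with $h_n y\to x$. *)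

(* Defs.v *)
From HB Require Import structures.
From mathcomp Require Import all_boot all_order all_algebra.
From mathcomp Require Import all_classical all_reals all_analysis.
From mathcomp Require Import borel_hierarchy.

Set Implicit Arguments.
Unset Strict Implicit.
Unset Printing Implicit Defensive.

Import Order.TTheory GRing.Theory Num.Theory.
Import numFieldNormedType.Exports.

Local Open Scope classical_set_scope.
Local Open Scope ring_scope.

HB.mixin Record isTopologicalGroup G & Group G & Topological G := {
  continuous_mulg : continuous (fun p : G * G => (p.1 * p.2)%g);
  continuous_invg : continuous (fun x : G => (x^-1)%g)
}.

#[short(type="topologicalGroupType")]
HB.structure Definition TopologicalGroup :=
  {G of Group G & Topological G & isTopologicalGroup G}.

Section Metrics.
Context (R : realType) (T : topologicalType).

(* The library's metricType fixes one distance per type; here one quantifies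
   over all the distances that induce the given topology of T. *)
Record compatible_metric (d : T -> T -> R) : Prop := CompatibleMetric {
  cmetricxx : forall x, d x x = 0;
  cmetric_positivity : forall x y, d x y = 0 -> x = y;
  cmetric_sym : forall x y, d x y = d y x;
  cmetric_triangle : forall y x z, d x z <= d x y + d y z;
  cmetric_nbhs : forall x, nbhs x = nbhs_ball_ (fun y e => [set z | d y z < e]) x
}.

Definition cauchy_seq_for (d : T -> T -> R) (u : nat -> T) : Prop :=
  forall e, 0 < e ->
    exists N, forall m n, (N <= m)%N -> (N <= n)%N -> d (u m) (u n) < e.

(* Sequential completeness; for a compatible metric, convergence in T is
   convergence for d. *)
Definition complete_for (d : T -> T -> R) : Prop :=
  forall u, cauchy_seq_for d u -> exists l : T, u @ \oo --> l.

Definition polish_space : Prop :=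
  (exists2 D : set T, countable D & dense D) /\
  (exists2 d : T -> T -> R, compatible_metric d & complete_for d).

End Metrics.

Arguments polish_space R T : clear implicits.

Section Groups.
Context (R : realType) (G : topologicalGroupType).

Definition subgroup_set (H : set G) : Prop :=
  H 1%g /\ forall x y, H x -> H y -> H (x * y^-1)%g.

Definition non_archimedean : Prop :=
  forall U : set G, nbhs (1%g : G) U ->
    exists H : set G, [/\ open H, subgroup_set H & H `<=` U].

Definition left_invariant (d : G -> G -> R) : Prop :=
  forall g x y, d (g * x)%g (g * y)%g = d x y.

Definition CLI : Prop :=
  exists d : G -> G -> R,
    [/\ compatible_metric d, left_invariant d & complete_for d].

Definition left_cauchy (h : nat -> G) : Prop :=
  exists d : G -> G -> R,
    [/\ compatible_metric d, left_invariant d & cauchy_seq_for d h].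

Definition right_cauchy (h : nat -> G) : Prop :=
  left_cauchy (fun n => (h n)^-1)%g.

Definition orbit_of (X : Type) (act : G -> X -> X) (x : X) : set X :=
  range (act^~ x).

Definition right_becker_embeds (X : topologicalType) (act : G -> X -> X)
    (x y : X) : Prop :=
  exists2 h : nat -> G, right_cauchy h & (fun n => act (h n) y) @ \oo --> x.

End Groups.

Arguments non_archimedean G : clear implicits.
Arguments CLI R G : clear implicits.
Arguments right_becker_embeds R [G X] act x y.

(* Used as a type, SymN carries the topology of pointwise convergence, nat
   being discrete; inversion is continuous for it, so that this is the usual
   topology of the permutation group. *)
Definition SymN : set {ptws nat -> nat} := [set f | bijective f].

(* a is an isomorphism of topological groups from G onto a closed subgroup of
   SymN; the first two fields say that the product on SymN is composition. *)
Record fundamental_action (G : topologicalGroupType) (a : G -> SymN) : Prop :=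
  FundamentalAction {
    fundamental_one : forall n, set_val (a 1%g) n = n;
    fundamental_mul : forall g h n,
      set_val (a (g * h)%g) n = set_val (a g) (set_val (a h) n);
    fundamental_inj : injective a;
    fundamental_open : forall U : set G,
      open U <-> exists2 V : set SymN, open V & a @^-1` V = U;
    fundamental_closed : closed (range a)
  }.

Definition bernoulli_shift (R : realType) (G : topologicalGroupType)
    (a : G -> SymN) (g : G) (x : {ptws nat -> R}) : {ptws nat -> R} :=
  fun n => x (set_val (a g^-1%g) n).

Definition comeager (T : topologicalType) (C : set T) : Prop :=
  exists2 D : set T, Gdelta_dense D & D `<=` C.

(* Main.v *)
Require Import Defs.
From mathcomp Require Import all_boot all_order all_algebra.
From mathcomp Require Import all_classical all_reals all_analysis.
From mathcomp Require Import borel_hierarchy.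

Set Implicit Arguments.
Unset Strict Implicit.
Unset Printing Implicit Defensive.

Import Order.TTheory GRing.Theory Num.Theory.
Import numFieldNormedType.Exports.

Local Open Scope classical_set_scope.
Local Open Scope ring_scope.

(** Identify [G] with a closed group of permutations of [nat].  A sequence
    [u] is left-Cauchy in [G] exactly when [u n i] is eventually constant for
    each [i]; the limit values form an injection [phi] of [nat].  If [phi] is
    onto, then it is a permutation, it lies in [G] because [G] is closed, and
    [u] converges to it.  So [G] fails to be CLI exactly when some left-Cauchy
    [u] has a limit [phi] that misses a point [m]
    ([not_CLI_nonsurjective_limit]).

    For [h n = (u n)^-1], the shifts of [y] by [h n] converge to [y \o phi],
    so [y \o phi] right Becker-embeds into every [y] ([becker_embeds_comp]).
    It remains to choose [y] generically: as [phi] is injective, composition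
    with [phi] pulls dense open sets back to dense open sets, so for a generic
    [y] both [y] and [y \o phi] lie in the given comeager set, and the value
    [y m] is taken nowhere else ([comeager_generic]).  Points in one orbit have
    the same values, and [y \o phi] misses the value [y m]; hence the two
    orbits differ ([comp_not_in_orbit]).

    Conversely, if [G] is CLI, then the right-Cauchy sequence of an embedding
    of [x] into [y] converges in [G], and its limit carries [y] to [x]; no
    embedding between different orbits exists, even in the whole space
    ([becker_embeds_orbit]). *)

(** * Basic neighbourhoods for pointwise convergence *)

Lemma nbhs_ptws_entourage (V : uniformType) (f : {ptws nat -> V})
    (A : set {ptws nat -> V}) :
  nbhs f A ->
  exists N, exists2 E : set (V * V), entourage E &
    [set g | forall i, (i < N)%N -> E (f i, g i)] `<=` A.
Proof.
pose F := filter_from [set p : nat * set (V * V) | entourage p.2]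
  (fun p => [set g : {ptws nat -> V} |
     forall i, (i < p.1)%N -> p.2 (f i, g i)]).
have FF : Filter F.
  apply: filter_from_filter; first by exists (0, setT); exact: entourageT.
  move=> [N E] [M E'] /= entE entE'.
  exists (maxn N M, E `&` E'); first exact: filterI.
  by move=> g /= gEE'; split=> i ltiN; case: (gEE' i) => //;
    rewrite (leq_trans ltiN) ?leq_maxl ?leq_maxr.
(* Convergence of the cylinder filter F to f says that cylinders refine the
   neighbourhoods of f, and it can be tested on each coordinate. *)
have cvgF : {ptws, F --> f}.
  apply/pointwise_cvgP => i B /nbhsP[E entE EB].
  exists (i.+1, E) => //= g /(_ i (ltnSn i)) Efg.
  by apply: EB; apply/xsectionP.
by move=> /cvgF[[N E] /= entE sub]; exists N, E.
Qed.

Lemma open_cylinder (V : topologicalType) (N : nat) (B : nat -> set V) :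
  (forall i, open (B i)) ->
  open [set g : {ptws nat -> V} | forall i, (i < N)%N -> B i (g i)].
Proof.
move=> oB; rewrite openE => f /= fB.
have : nbhs f [set g : {ptws nat -> V} | forall i : 'I_N, B i (g i)].
  apply: (@filter_forall _ _ (fun (i : 'I_N) (g : {ptws nat -> V}) => B i (g i))
    (nbhs f)) => i.
  have nB : nbhs (f i) (B i).
    by apply: open_nbhs_nbhs; split; [exact: oB|exact: fB].
  exact: (@proj_continuous nat (fun=> V) i f (B i) nB).
by apply: filterS => g gB i ltiN; exact: (gB (Ordinal ltiN)).
Qed.

Lemma nbhs_ptws_box (R : realType) (f : {ptws nat -> R})
    (A : set {ptws nat -> R}) :
  nbhs f A ->
  exists N, exists2 e : R, 0 < e &
    [set g | forall i, (i < N)%N -> `|g i - f i| <= e] `<=` A.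
Proof.
move=> /nbhs_ptws_entourage[N [E + EA]].
rewrite -entourage_ballE => -[e /= e0 eE].
exists N, (e / 2); first by rewrite divr_gt0.
move=> g /= gfe; apply: EA => i /gfe {}gfe.
apply: eE => /=; rewrite -ball_normE /= distrC.
by apply: le_lt_trans gfe _; rewrite ltr_pdivrMr // ltr_pMr // ltr1n.
Qed.

(** * Baire category in the space of real sequences *)

Section Baire.
Context (R : realType).

Definition box_interior (N : nat) (c : nat -> R) (e : R) : set {ptws nat -> R} :=
  [set g | forall i, (i < N)%N -> `|g i - c i| < e].

Lemma open_box_interior N c e : open (box_interior N c e).
Proof.
apply: (@open_cylinder _ N (fun i => [set z | `|z - c i| < e])) => i.
have := @ball_open R R^o (c i) e; rewrite -ball_normE.
by under [X in open X -> _]eq_set => z do rewrite distrC.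
Qed.

(** The induction step of the Baire argument.  The inclusion of intervals in
    the first [N] coordinates is read off the points of the new box all of
    whose coordinates are left, or right, endpoints. *)
Lemma shrink_box (O : set {ptws nat -> R}) N c e :
  open O -> dense O -> 0 < e ->
  exists M d r, [/\ (N <= M)%N, 0 < r,
    (forall i, (i < N)%N -> c i - e <= d i - r /\ d i + r <= c i + e) &
    [set g : {ptws nat -> R} | forall i, (i < M)%N -> `|g i - d i| <= r]
      `<=` O].
Proof.
move=> oO dO e0.
have [f [fbox fO]] : box_interior N c e `&` O !=set0.
  apply: dO (open_box_interior N c e).
  by exists c => i _; rewrite subrr normr0.
have [M [r r0 rsub]] : exists M, exists2 r, 0 < r &
    [set g : {ptws nat -> R} | forall i, (i < M)%N -> `|g i - f i| <= r]
      `<=` box_interior N c e `&` O.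
  apply: nbhs_ptws_box; apply: open_nbhs_nbhs; split => //.
  by apply: openI => //; exact: open_box_interior.
exists (maxn N M), f, r; split; rewrite ?leq_maxl //.
- move=> i ltiN.
  have [|/(_ i ltiN) lo _] := rsub (fun i => f i - r).
    by move=> k _; rewrite addrAC subrr sub0r normrN gtr0_norm.
  have [|/(_ i ltiN) hi _] := rsub (fun i => f i + r).
    by move=> k _; rewrite addrAC subrr add0r gtr0_norm.
  move: lo hi; rewrite !ltr_norml => /andP[lo _] /andP[_ hi].
  by rewrite ltrBrDl in lo; rewrite ltrBlDl in hi; split; exact: ltW.
- move=> g gbox; apply: (rsub g _).2 => i ltiM; apply: gbox.
  by rewrite (leq_trans ltiM) ?leq_maxr.
Qed.

(** The Baire category theorem for this space: a point in all the sets is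
    found in a nested sequence of finite-dimensional closed boxes.  The radii
    need not shrink to 0 and the dimensions need not grow: in each
    coordinate, the supremum of the left endpoints lies in all the intervals
    imposed there, and a coordinate that is never constrained is free. *)
Lemma dense_open_meet (O : nat -> set {ptws nat -> R}) :
  (forall n, open (O n)) -> (forall n, dense (O n)) ->
  exists y, forall n, O n y.
Proof.
move=> oO dO.
(* A state is a stage n together with a box, given by its dimension, centre
   and radius. *)
pose good (s t : nat * (nat * (nat -> R) * R)) :=
  0 < s.2.2 -> let: (n, (N, c, e)) := s in let: (n', (M, d, r)) := t in
  [/\ n' = n.+1, (N <= M)%N, 0 < r,
    (forall i, (i < N)%N -> c i - e <= d i - r /\ d i + r <= c i + e) &
    [set g : {ptws nat -> R} | forall i, (i < M)%N -> `|g i - d i| <= r]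
      `<=` O n].
have step s : {t | good s t}.
  apply: cid; case: s => n [[N c] e].
  have [e0|e0] := ltP 0 e; last first.
    by exists (n, (N, c, e)); rewrite /good /= ltNge e0.
  have [M [d [r [NM r0 cd dO']]]] := @shrink_box (O n) N c e (oO n) (dO n) e0.
  by exists (n.+1, (M, d, r)) => _; split.
have [b [b0 bS]] := dependent_choice step (0, (0, (fun=> 0), 1)).
pose N k := (b k).2.1.1; pose c k := (b k).2.1.2; pose e k := (b k).2.2.
have e0 k : 0 < e k.
  elim: k => [|k IH]; first by rewrite /e b0.
  move: IH (bS k); rewrite /good /e.
  by case: (b k) (b k.+1) => [n [[? ?] ?]] [n' [[? ?] ?]] /= IH /(_ IH)[].
have bstep k : [/\ (b k.+1).1 = (b k).1.+1, (N k <= N k.+1)%N,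
    (forall i, (i < N k)%N -> c k i - e k <= c k.+1 i - e k.+1 /\
       c k.+1 i + e k.+1 <= c k i + e k) &
    [set g : {ptws nat -> R} | forall i, (i < N k.+1)%N ->
       `|g i - c k.+1 i| <= e k.+1] `<=` O (b k).1].
  move: (e0 k) (bS k); rewrite /good /N /c /e.
  by case: (b k) (b k.+1) => [n [[? ?] ?]] [n' [[? ?] ?]] /= e0k /(_ e0k)[].
have bidx k : (b k).1 = k.
  by elim: k => [|k IH]; [rewrite b0|have [-> _ _ _] := bstep k; rewrite IH].
have nested k m : (k <= m)%N -> (N k <= N m)%N /\
    forall i, (i < N k)%N -> c k i - e k <= c m i - e m /\
      c m i + e m <= c k i + e k.
  elim: m => [|m IH]; first by rewrite leqn0 => /eqP->; split.
  rewrite leq_eqVlt => /predU1P[<-|]; first by split.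
  rewrite ltnS => /IH[Nkm ckm]; have [_ Nm cm _] := bstep m.
  split=> [|i ltiN]; first exact: leq_trans Nkm Nm.
  have [l1 u1] := ckm i ltiN.
  have [l2 u2] := cm i (leq_trans ltiN Nkm).
  by split; [exact: le_trans l1 l2|exact: le_trans u2 u1].
have width k i : c k i - e k <= c k i + e k.
  by rewrite lerD2l (le_trans _ (ltW (e0 k))) // oppr_le0 ltW.
have cross k m i : (i < N k)%N -> (i < N m)%N -> c k i - e k <= c m i + e m.
  move=> ik im.
  have [/nested[_ /(_ i ik)[l _]]|/ltnW/nested[_ /(_ i im)[_ u]]] := leqP k m.
    exact: le_trans l (width m i).
  exact: le_trans (width k i) u.
pose L i := [set x | exists2 k, (i < N k)%N & x = c k i - e k].
exists (fun i => sup (L i)) => n.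
have [_ _ _ sub] := bstep n; rewrite bidx in sub; apply: sub => i ltiN /=.
have lo : c n.+1 i - e n.+1 <= sup (L i).
  apply: ub_le_sup; last by exists n.+1.
  by exists (c n.+1 i + e n.+1) => _ [k ltik ->]; exact: cross.
have hi : sup (L i) <= c n.+1 i + e n.+1.
  apply: ge_sup; first by exists (c n.+1 i - e n.+1), n.+1.
  by move=> _ [k ltik ->]; exact: cross.
by rewrite ler_norml lerBlDl lerBrDl lo hi.
Qed.

End Baire.

(** * Left-Cauchy sequences of permutations *)

Section CauchyInGroups.
Context (R : realType) (G : topologicalGroupType).

(** For a left-invariant [d], being Cauchy only depends on the neighbourhoods
    of 1 that contain [(u m)^-1 * u n]; hence it does not depend on the
    compatible metric. *)
Lemma cauchy_left_invariant (d d' : G -> G -> R) (u : nat -> G) :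
  compatible_metric d -> left_invariant d ->
  compatible_metric d' -> left_invariant d' ->
  cauchy_seq_for d' u -> cauchy_seq_for d u.
Proof.
move=> cd ld cd' ld' cu e e0.
have : nbhs (1%g : G) [set z | d 1%g z < e].
  by rewrite (cmetric_nbhs cd); exists e.
rewrite (cmetric_nbhs cd') => -[r /= r0 rsub].
have [N uN] := cu r r0; exists N => m n Nm Nn.
rewrite -(ld (u m)^-1)%g mulVg; apply: rsub => /=.
by rewrite -(ld' (u m)) mulg1 mulVKg; exact: uN.
Qed.

End CauchyInGroups.

Section FundamentalAction.
Context (R : realType) (G : topologicalGroupType).
Context (a : G -> SymN) (fund_a : fundamental_action a).

Local Notation "g '•' n" := (set_val (a g) n) (at level 40).

Lemma fundamental_inv g n : g^-1%g • (g • n) = n.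
Proof. by rewrite -(fundamental_mul fund_a) mulVg (fundamental_one fund_a). Qed.

Lemma fundamental_ext g h : (forall n, g • n = h • n) -> g = h.
Proof.
move=> gh; apply: (fundamental_inj fund_a); apply: val_inj.
exact/funext.
Qed.

Lemma nbhs_fundamental (g : G) (A : set G) :
  nbhs g A <->
  exists N, [set h | forall i, (i < N)%N -> h • i = g • i] `<=` A.
Proof.
split=> [|[N sub]].
  rewrite nbhsE => -[U [oU Ug] UA].
  have [V oV VU] := (fundamental_open fund_a U).1 oU.
  case: oV => W oW WV.
  have Wg : W (set_val (a g)) by move: Ug; rewrite -VU -WV.
  have [N [E entE EW]] := nbhs_ptws_entourage (open_nbhs_nbhs (conj oW Wg)).
  exists N => h hg; apply: UA; rewrite -VU -WV; apply: EW => i ltiN.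
  by rewrite hg //; exact: entourage_refl.
apply: filterS sub _; apply: open_nbhs_nbhs; split; last by [].
apply/(fundamental_open fund_a).
exists (set_val @^-1` [set f : {ptws nat -> nat} |
  forall i, (i < N)%N -> [set g • i] (f i)]); last by [].
exists [set f : {ptws nat -> nat} | forall i, (i < N)%N -> [set g • i] (f i)].
  by apply: (@open_cylinder nat N (fun i => [set g • i])) => i; exact: discrete_open.
by [].
Qed.

Lemma cvg_fundamental (u : nat -> G) (g : G) :
  u @ \oo --> g <-> forall i, \forall n \near \oo, u n • i = g • i.
Proof.
split=> [ug i|ug A /nbhs_fundamental[N sub]].
  apply: (ug [set h | h • i = g • i]); apply/nbhs_fundamental.
  by exists i.+1 => h /(_ i (ltnSn i)).
have : \forall n \near \oo, forall i : 'I_N, u n • i = g • i.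
  by apply: filter_forall => i; exact: ug.
by apply: filterS => n un; apply: sub => i ltiN; exact: (un (Ordinal ltiN)).
Qed.

(** The value is the inverse of [n.+1] for the first [n] at which [g] and [h]
    differ; adding 0 to the set covers the case [g = h]. *)
Definition perm_dist (g h : G) : R :=
  sup [set x | x = 0 \/ exists2 n, g • n <> h • n & x = n.+1%:R^-1].

Lemma perm_dist_le (g h : G) (e : R) :
  perm_dist g h <= e <->
  0 <= e /\ forall n, g • n <> h • n -> n.+1%:R^-1 <= e.
Proof.
rewrite /perm_dist; set S := [set x | _].
have ubS : has_ubound S.
  exists 1 => _ [->|[n _ ->]]; first exact: ler01.
  by rewrite invf_le1 ?ltr0n // ler1n.
split=> [le_e|[e0 le_e]].
  by split=> [|n gh]; (apply: le_trans le_e; apply: ub_le_sup => //);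
    [left|right; exists n].
by apply: ge_sup; [exists 0; left|move=> _ [->//|[n /le_e + ->]]].
Qed.

Lemma perm_dist_lt (g h : G) (k : nat) :
  perm_dist g h < k.+1%:R^-1 <-> forall i, (i < k.+1)%N -> g • i = h • i.
Proof.
split=> [lt_k i leik|gh].
  apply: contrapT => ghi.
  have [_ /(_ i ghi)] := (perm_dist_le g h _).1 (lexx _).
  by rewrite leNgt (lt_le_trans lt_k) // lef_pV2 ?posrE ?ltr0n // ler_nat.
apply: (@le_lt_trans _ _ k.+2%:R^-1); last by rewrite ltf_pV2 ?posrE ?ltr0n // ltr_nat.
apply/perm_dist_le; split=> [|i ghi]; first by rewrite invr_ge0 ler0n.
rewrite lef_pV2 ?posrE ?ltr0n // ler_nat ltnNge; apply/negP => leik.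
by apply: ghi; exact: gh.
Qed.

Lemma perm_dist_left_invariant : left_invariant perm_dist.
Proof.
move=> f g h; congr sup; apply/seteqP.
have fE n : (f * g)%g • n = (f * h)%g • n <-> g • n = h • n.
  rewrite !(fundamental_mul fund_a); split=> [E|-> //].
  by rewrite -(fundamental_inv f (g • n)) E fundamental_inv.
by split=> x [->|[n ne ->]]; [left|right|left|right] => //;
  exists n => // E; apply: ne; apply/fE.
Qed.

Lemma small_invr (e : R) : 0 < e -> exists k, k.+1%:R^-1 < e.
Proof. by move=> /ltr_add_invr[k]; rewrite add0r; exists k. Qed.

Lemma perm_dist_compatible : compatible_metric perm_dist.
Proof.
have ge0 g h : 0 <= perm_dist g h.
  by have [] := (perm_dist_le g h _).1 (lexx _).
split.
- move=> g; apply/le_anti; rewrite ge0 andbT.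
  by apply/perm_dist_le; split.
- move=> g h gh0; apply: fundamental_ext => n.
  apply: (perm_dist_lt g h n).1 (ltnSn n).
  by rewrite gh0 invr_gt0 ltr0n.
- move=> g h; congr sup; apply/seteqP.
  by split=> x [->|[n ne ->]]; [left|right|left|right] => //;
    exists n => // E; apply: ne.
- move=> h g k; apply/perm_dist_le; split; first exact: addr_ge0.
  move=> n gk; have [gh|gh] := pselect (g • n = h • n).
    apply: ler_wpDl => //.
    by apply: ((perm_dist_le h k _).1 (lexx _)).2; rewrite -gh.
  apply: ler_wpDr => //.
  exact: ((perm_dist_le g h _).1 (lexx _)).2.
- move=> g; apply/seteqP; split=> A.
    move=> /nbhs_fundamental[N sub]; exists N.+1%:R^-1 => /=.
      by rewrite invr_gt0 ltr0n.
    move=> h /= /perm_dist_lt gh; apply: sub => i ltiN.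
    by rewrite gh // ltnW.
  move=> [e /= e0 esub]; apply/nbhs_fundamental.
  have [k ke] := small_invr e0.
  exists k.+1 => h hg; apply: esub => /=; apply: lt_trans ke.
  by apply/perm_dist_lt => i leik; rewrite hg.
Qed.

Lemma cauchy_perm_dist (u : nat -> G) :
  cauchy_seq_for perm_dist u ->
  forall i, exists v, \forall n \near \oo, u n • i = v.
Proof.
move=> cu i; have i0 : 0 < i.+1%:R^-1 :> R by rewrite invr_gt0 ltr0n.
have [N uN] := cu _ i0; exists (u N • i).
exists N => // n /= Nn.
exact: ((perm_dist_lt _ _ _).1 (uN n N Nn (leqnn N)) i (ltnSn i)).
Qed.

(** Since [perm_dist] is compatible and left-invariant, it is not complete; the
    witness is a Cauchy sequence without limit.  Were its pointwise limit
    onto, it would be a permutation in the closure of [G], hence in [G]. *)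
Lemma not_CLI_nonsurjective_limit :
  ~ CLI R G ->
  exists (u : nat -> G) (phi : nat -> nat) (m : nat),
    [/\ left_cauchy R u, forall i, \forall n \near \oo, u n • i = phi i,
        injective phi & forall i, phi i <> m].
Proof.
move=> nCLI.
have : ~ complete_for perm_dist.
  move=> complete; apply: nCLI; exists perm_dist; split => //.
    exact: perm_dist_compatible.
  exact: perm_dist_left_invariant.
move=> /existsNP[u /not_implyP[cu nlim]].
have [phi uphi] := choice (cauchy_perm_dist cu).
have phi_inj : injective phi.
  move=> i j phiij.
  have [n [ui uj]] := filter_ex (filterI (uphi i) (uphi j)).
  by rewrite -(fundamental_inv (u n) i) ui phiij -uj fundamental_inv.
exists u, phi.
apply: contrapT => nm; apply: nlim.
have phi_surj m : exists i, phi i = m.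
  apply: contrapT => mphi; apply: nm; exists m; split=> //.
    exists perm_dist; split => //.
      exact: perm_dist_compatible.
    exact: perm_dist_left_invariant.
  by move=> i phiim; apply: mphi; exists i.
have [psi psiK] := choice phi_surj.
have phi_bij : bijective phi.
  by exists psi => // i; apply: phi_inj; rewrite psiK.
pose p : SymN := exist _ (phi : {ptws nat -> nat}) (mem_set phi_bij).
have [g _ agp] : range a p.
  apply: (fundamental_closed fund_a) => B [_ [[W oW <-] Wp] WB].
  have [N [E entE EW]] := nbhs_ptws_entourage (open_nbhs_nbhs (conj oW Wp)).
  have : \forall n \near \oo, forall i : 'I_N, u n • i = phi i.
    by apply: filter_forall => i; exact: uphi.
  move=> /filter_ex[n un]; exists (a (u n)); split; first by exists (u n).
  apply: WB; apply: EW => i ltiN.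
  by rewrite (un (Ordinal ltiN)); exact: entourage_refl.
exists g; apply/cvg_fundamental => i; rewrite agp; exact: uphi.
Qed.

(** * The Bernoulli shift *)

Lemma bernoulli_shiftM (g h : G) (x : {ptws nat -> R}) :
  bernoulli_shift a g (bernoulli_shift a h x) = bernoulli_shift a (g * h)%g x.
Proof.
by apply/funext => n; rewrite /bernoulli_shift -(fundamental_mul fund_a) invgM.
Qed.

Lemma orbit_bernoulli_shift (g : G) (x : {ptws nat -> R}) :
  orbit_of (bernoulli_shift a) (bernoulli_shift a g x) =
  orbit_of (bernoulli_shift a) x.
Proof.
apply/seteqP; split=> _ [h _ <-].
  by exists (h * g)%g => //; rewrite bernoulli_shiftM.
by exists (h * g^-1)%g => //; rewrite bernoulli_shiftM mulgVK.
Qed.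

(** In a CLI group the inverses of the right-Cauchy sequence converge to some
    [l], and then the shifts of [y] converge to the shift of [y] by [l^-1]. *)
Lemma becker_embeds_orbit (x y : {ptws nat -> R}) :
  CLI R G -> right_becker_embeds R (bernoulli_shift a) x y ->
  orbit_of (bernoulli_shift a) x = orbit_of (bernoulli_shift a) y.
Proof.
move=> [d [cd ld dcomplete]] [h [d' [cd' ld' ch]] hx].
have [l /cvg_fundamental hl] :=
  dcomplete _ (cauchy_left_invariant cd ld cd' ld' ch).
suff -> : x = bernoulli_shift a l^-1%g y by exact: orbit_bernoulli_shift.
apply/funext => i.
have cvgx : (fun n => bernoulli_shift a (h n) y i) @ \oo --> x i.
  by have /pointwise_cvgP := hx; exact.
apply: (cvg_unique (@Rhausdorff R) cvgx).
rewrite /bernoulli_shift invgK; apply: cvg_near_cst.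
by apply: filterS (hl i) => n ->.
Qed.

Lemma becker_embeds_comp (u : nat -> G) (phi : nat -> nat)
    (y : {ptws nat -> R}) :
  left_cauchy R u -> (forall i, \forall n \near \oo, u n • i = phi i) ->
  right_becker_embeds R (bernoulli_shift a) (y \o phi) y.
Proof.
move=> cu uphi; exists (fun n => (u n)^-1)%g.
  rewrite /right_cauchy (_ : (fun n => _) = u) //.
  by apply/funext => n; exact: invgK.
apply/pointwise_cvgP => i; apply: cvg_near_cst.
by apply: filterS (uphi i) => n /=; rewrite /bernoulli_shift invgK => ->.
Qed.

Lemma comp_not_in_orbit (phi : nat -> nat) (m : nat) (y : {ptws nat -> R}) :
  (forall i, phi i <> m) -> (forall i, i <> m -> y i <> y m) ->
  orbit_of (bernoulli_shift a) (y \o phi) <> orbit_of (bernoulli_shift a) y.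
Proof.
move=> phim ym orbE.
have : orbit_of (bernoulli_shift a) (y \o phi) y.
  rewrite orbE; exists 1%g => //; apply/funext => n.
  by rewrite /bernoulli_shift invg1 (fundamental_one fund_a).
by move=> [g _ /(congr1 (@^~ m))]; exact: ym.
Qed.

End FundamentalAction.

(** * Generic points *)

Section Generic.
Context (R : realType).

(** Only finitely many coordinates are sent below [N]; this is what makes
    composition with [phi] an open map. *)
Lemma injective_unbounded (phi : nat -> nat) :
  injective phi -> forall N, exists M, forall j, (phi j < N)%N -> (j < M)%N.
Proof.
move=> phi_inj; elim=> [|N [M lt_M]]; first by exists 0.
have [[j0 phij0]|noj] := pselect (exists j, phi j = N).
  exists (maxn M j0.+1) => j; rewrite ltnS leq_eqVlt => /predU1P[|/lt_M ltjM].
    by rewrite -phij0 => /phi_inj ->; rewrite leq_maxr.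
  by rewrite (leq_trans ltjM) ?leq_maxl.
exists M => j; rewrite ltnS leq_eqVlt => /predU1P[phij|/lt_M //].
by case: noj; exists j.
Qed.

Lemma continuous_comp_ptws (phi : nat -> nat) :
  continuous (fun y : {ptws nat -> R} => (y \o phi : {ptws nat -> R})).
Proof.
move=> y.
pose F : set_system {ptws nat -> R} :=
  (fun z : {ptws nat -> R} => z \o phi : {ptws nat -> R}) @ nbhs y.
have FF : Filter F by exact: fmap_filter.
apply: (@pointwise_cvgP nat R F (y \o phi) FF).2 => i A nA.
exact: (@proj_continuous nat (fun=> R : topologicalType) (phi i) y A nA).
Qed.

(** A basic neighbourhood of [y] constrains finitely many coordinates.  Choose
    [w] in [O] close to [y \o phi] wherever [phi] hits one of these; as [phi]
    is injective, [w] can be written [z \o phi] with [z] equal to [y] outside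
    the range of [phi], and then [z] is still close to [y]. *)
Lemma dense_preimage_comp (phi : nat -> nat) (O : set {ptws nat -> R}) :
  injective phi -> dense O -> dense [set y : {ptws nat -> R} | O (y \o phi)].
Proof.
move=> phi_inj dO U [y Uy] oU.
have [N [e e0 eU]] := nbhs_ptws_box (open_nbhs_nbhs (conj oU Uy)).
have [M phiM] := injective_unbounded phi_inj N.
have [w [wbox Ow]] : box_interior M (y \o phi) e `&` O !=set0.
  apply: dO (open_box_interior _ _ _).
  by exists (y \o phi) => i _; rewrite subrr normr0.
pose extends k v := (forall j, phi j = k -> v = w j) /\
  ((forall j, phi j <> k) -> v = y k).
have [z zw] : {z : nat -> R & forall k, extends k (z k)}.
  apply: choice => k; have [[j phij]|nk] := pselect (exists j, phi j = k).
    exists (w j); split=> [j'|/(_ j) //].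
    by rewrite -phij => /phi_inj ->.
  by exists (y k); split=> // j phij; case: nk; exists j.
have zphi : z \o phi = w by apply/funext => j /=; apply: (zw _).1.
exists z; split; last by rewrite /= zphi.
apply: eU => k ltkN /=.
have [[j phij]|nk] := pselect (exists j, phi j = k).
  rewrite ((zw k).1 j phij) -phij; apply/ltW/wbox/phiM.
  by rewrite phij.
rewrite (zw k).2 ?subrr ?normr0 ?ltW // => j phij.
by apply: nk; exists j.
Qed.

Lemma open_neq_coord (i m : nat) : open [set y : {ptws nat -> R} | y i <> y m].
Proof.
rewrite (_ : [set y | _] =
    (fun y : {ptws nat -> R} => y i - y m) @^-1` (~` [set 0])).
  apply: open_comp; last by rewrite openC; exact: closed_eq.
  move=> y _; apply: (@continuousB R R^o).
    exact: (@proj_continuous nat (fun=> R) i y).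
  exact: (@proj_continuous nat (fun=> R) m y).
apply/seteqP; split=> y /= ne E; apply: ne.
  by apply/eqP; rewrite -subr_eq0 E.
by rewrite E subrr.
Qed.

Lemma dense_neq_coord (i m : nat) :
  i <> m -> dense [set y : {ptws nat -> R} | y i <> y m].
Proof.
move=> /eqP im U [y Uy] oU.
have [yim|?] := pselect (y i = y m); last by exists y.
have [N [e e0 eU]] := nbhs_ptws_box (open_nbhs_nbhs (conj oU Uy)).
exists (fun k => if k == m then y m + e else y k); split=> /=.
  apply: eU => k _ /=; case: eqP => [->|_].
    by rewrite addrAC subrr add0r gtr0_norm.
  by rewrite subrr normr0 ltW.
rewrite eqxx (negPf im) yim => /eqP.
by rewrite -subr_eq0 opprD addrA subrr sub0r oppr_eq0 (gt_eqF e0).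
Qed.

Lemma comeager_generic (phi : nat -> nat) (m : nat) (C : set {ptws nat -> R}) :
  injective phi -> comeager C ->
  exists y : {ptws nat -> R},
    [/\ C y, C (y \o phi) & forall i, i <> m -> y i <> y m].
Proof.
move=> phi_inj [D [F odF ->] DC].
pose Fphi n := [set y : {ptws nat -> R} | F n (y \o phi)].
(* bump m enumerates the coordinates different from m. *)
pose apart n := [set y : {ptws nat -> R} | y (bump m n) <> y m].
have oFphi n : open (Fphi n).
  apply: (@open_comp _ _
    (fun y : {ptws nat -> R} => (y \o phi : {ptws nat -> R}))).
    by move=> y _; exact: continuous_comp_ptws.
  by have [] := odF n.
have [y Oy] : exists y, forall n, (F n `&` Fphi n `&` apart n) y.
  apply: dense_open_meet => n; have [oFn dFn] := odF n.
    by apply: openI; [exact: openI|exact: open_neq_coord].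
  apply: denseI; first exact: openI.
    by apply: denseI => //; exact: dense_preimage_comp.
  by apply: dense_neq_coord => /esym/eqP; exact/negP/neq_bump.
exists y; split=> [||i /eqP im].
- by apply: DC => n _; have [[]] := Oy n.
- by apply: DC => n _; have [[]] := Oy n.
- by have [_] := Oy (unbump m i); rewrite /apart /= unbumpKcond (negPf im).
Qed.

End Generic.

(** * The characterization of CLI groups *)

Theorem mainTheorem6 (R : realType) (G : topologicalGroupType)
    (polishG : polish_space R G) (naG : non_archimedean G)
    (a : G -> SymN) (fund_a : fundamental_action a) :
  ~ CLI R G <->
  (forall C : set {ptws nat -> R}, comeager C ->
     exists x y : {ptws nat -> R},
       [/\ C x, C y,
           orbit_of (bernoulli_shift a) x <> orbit_of (bernoulli_shift a) y
         & right_becker_embeds R (bernoulli_shift a) x y]).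
Proof.
split=> [nCLI C comC|generic cliG].
  have [u [phi [m [cu uphi phi_inj phim]]]] :=
    not_CLI_nonsurjective_limit fund_a nCLI.
  have [y [Cy Cyphi ym]] := comeager_generic m phi_inj comC.
  exists (y \o phi), y; split=> //; first exact: comp_not_in_orbit phim ym.
  exact: becker_embeds_comp cu uphi.
have comT : comeager [set: {ptws nat -> R}].
  exists setT => //; exists (fun=> setT); last by rewrite bigcapT.
  by move=> n; split; [exact: openT|move=> U [y Uy] _; exists y].
have [x [y [_ _ orb_neq embed]]] := generic _ comT.
by apply: orb_neq; exact: becker_embeds_orbit embed.
Qed.
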